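(* Let $\mathfrak{X}_m=(X_1,\dots,X_m)$ be a random $\mathbb{Z}_n$-sequence, i.e. the $X_i$ are independent and uniformly distributed on $\mathbb{Z}_n$. Then with high probability (as $n\to\infty$) the following statements hold. (1) $\mathfrak{X}_{n+2}$ is an Erdős Z-sequence. (2) Let $A=\{a,b\}\subset\mathbb{Z}_n\setminus\{0\}$ (where $A$ may depend on $n$). Suppose $A\cap\mathbb{Z}_n^*\neq\emptyset$ and suppose also that $a+b,\ a-b\in\mathbb{Z}_n^*$. Then $\mathfrak{X}_n$ is an $A$-weighted Erdős Z-sequence. (3) Let $A=\{1,-1\}$. Then $\mathfrak{X}_{n+1}$ is an $A$-weighted Erdős Z-sequence.
   Context: $\mathbb{Z}_n$ is the ring of integers modulo $n$ and $\mathbb{Z}_n^*$ its group of units. For $A\subseteq\mathbb{Z}_n\setminus\{0\}$, a sequence $\mathbf{x}=(x_1,\dots,x_m)\in(\mathbb{Z}_n)^m$ is an $A$-weighted Erdős Z-sequence if there exists $\mathbf{a}=(a_1,\dots,a_m)\in(A\cup\{0\})^m$ with $|\{i:a_i\neq 0\}|=n$ such that $\sum_{i=1}^m a_ix_i=0$ in $\mathbb{Z}_n$. It is an Erdős Z-sequence if this holds with $A=\{1\}$, i.e. if there is $I\subseteq\{1,\dots,m\}$ with $|I|=n$ and $\sum_{i\in I}x_i=0$. ''With high probability (as $n\to\infty$)'' means with probability approaching $1$ as $n\to\infty$: for every $\varepsilon>0$ there is $n_0$ such that for all $n\ge n_0$ (and, in part (2), for all sets $A=\{a,b\}$ satisfying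 the stated hypotheses for that $n$) the stated event has probability at least $1-\varepsilon$. *)

(* Defs.v *)
From HB Require Import structures.
From mathcomp Require Import all_boot all_order all_algebra.
From mathcomp Require Import all_classical all_reals all_analysis.

Set Implicit Arguments.
Unset Strict Implicit.
Unset Printing Implicit Defensive.

Import Order.TTheory GRing.Theory Num.Theory.

Local Open Scope classical_set_scope.
Local Open Scope ring_scope.

(* The discrete sigma-algebra on ordinals, hence on Z/n: ['Z_n] unfolds to
   ['I_(Zp_trunc n).+2]. *)
HB.instance Definition _ (n : nat) := isPointed.Build 'I_n.+1 ord0.

HB.instance Definition _ (n : nat) := @isMeasurable.Build
  default_measure_display 'I_n.+1 (@discrete_measurable 'I_n.+1)
  (@discrete_measurable0 _) (@discrete_measurableC _) (@discrete_measurableU _).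

(* Here and below [n] is meant to be at least 2, as ['Z_0] and ['Z_1] both
   denote Z/2.  Allowing the zero weight, the condition on the support says that
   exactly [n] terms of the sequence are used. *)
Definition weighted_erdos_zseq (n m : nat) (A : {set 'Z_n})
    (x : 'I_m -> 'Z_n) : Prop :=
  exists a : 'I_m -> 'Z_n,
    [/\ forall i, a i \in (0 |: A)%SET,
        #|[set i | a i != 0]%SET| = n
      & \sum_(i < m) a i * x i = 0].

Definition erdos_zseq (n m : nat) (x : 'I_m -> 'Z_n) : Prop :=
  weighted_erdos_zseq [set 1]%SET x.

Definition mutually_independent d d' (T : measurableType d)
    (T' : measurableType d') (R : realType) (P : probability T R)
    (I : finType) (X : I -> {RV P >-> T'}) : Prop :=
  forall (J : {set I}) (B : I -> set T'), (forall i, measurable (B i)) ->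
    P (\bigcap_(i in [set` J]) (X i @^-1` B i)) =
    (\prod_(i in J) P (X i @^-1` B i))%E.

Definition uniformly_distributed (n : nat) d (T : measurableType d)
    (R : realType) (P : probability T R) (X : {RV P >-> 'Z_n}) : Prop :=
  forall z : 'Z_n, P (X @^-1` [set z]) = (n%:R^-1)%:E.

Definition random_Zn_sequence (n m : nat) d (T : measurableType d)
    (R : realType) (P : probability T R) (X : 'I_m -> {RV P >-> 'Z_n}) : Prop :=
  mutually_independent X /\ forall i, uniformly_distributed (X i).

(* Main.v *)
(* Second moment method. Fix a family [F] of admissible weight vectors [c] and
   count, for a uniform [x] in (Z/n)^m, the [c] in [F] with [c . x = 0]. Each
   event has probability 1/n, and two of them are independent as soon as the two
   weight vectors have a 2x2 minor that is a unit.
   In (1) and (2) the weights take the value [p] on a 2-element set and [q] off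
   it, with ([p], [q]) = (0, 1), resp. ([a], [b]); distinct 2-element sets give
   the minor [p^2 - q^2], a unit, so the expected number of solutions
   ['C(m, 2) / n] tends to infinity and Chebyshev's inequality concludes.
   In (3) the weights are 0 at [k], -1 at [l] and 1 elsewhere. Two pairs (k, l)
   with distinct [k] are independent; for equal [k] there is a minor equal to 2,
   and since [2 t = c] has at most two solutions modulo [n] the joint probability
   is at most 4/n^2. Such pairs form only a fraction 1/(n+1) of all pairs, which
   adds O(1/n) to the normalised variance. *)
Require Import Defs.
From HB Require Import structures.
From mathcomp Require Import all_boot all_order all_algebra.
From mathcomp Require Import all_classical all_reals all_analysis.
From mathcomp Require Import ring lra zify.

Set Implicit Arguments.
Unset Strict Implicit.
Unset Printing Implicit Defensive.

Import Order.TTheory GRing.Theory Num.Theory.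

Local Open Scope classical_set_scope.
Local Open Scope ring_scope.

(** * The second moment inequality, in counting form *)

(** Chebyshev's inequality for [N v], the number of [c] in [F] with [v] in [E c]. The quantity
    [mu = p * #|F|] bounds the mean of [N] from below, and [delta] measures the relative excess of
    the pair correlations over independence. *)
Lemma second_moment (R : realFieldType) (V I : finType) (E : I -> {set V})
    (F : {set I}) (p delta : R) :
  0 < p * #|F|%:R ->
  (forall c, c \in F -> p * #|V|%:R <= #|E c|%:R) ->
  \sum_(c in F) \sum_(c' in F) #|E c :&: E c'|%:R <=
    (p * #|F|%:R + (1 + delta) * (p * #|F|%:R) ^+ 2) * #|V|%:R ->
  (1 - delta - (p * #|F|%:R)^-1) * #|V|%:R <=
    #|[set v | [exists c in F, v \in E c]]%SET|%:R.
Proof.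
set mu := p * _ => mu_gt0 E_ge EE_le.
pose N v : R := \sum_(c in F) (v \in E c)%:R.
have cardE (A : {set V}) : \sum_v (v \in A)%:R = #|A|%:R :> R.
  by rewrite -sum1_card natr_sum [RHS]big_mkcond /=; apply: eq_bigr => v _; case: ifP.
have N1 : mu * #|V|%:R <= \sum_v N v.
  rewrite /N exchange_big /= /mu mulrAC mulr_natr -sumr_const.
  by apply: ler_sum => c cF; rewrite cardE E_ge.
have N2 : \sum_v N v ^+ 2 <= (mu + (1 + delta) * mu ^+ 2) * #|V|%:R.
  apply: le_trans EE_le; rewrite le_eqVlt; apply/orP; left; apply/eqP.
  under eq_bigr do rewrite expr2 /N big_distrlr /=.
  rewrite exchange_big /=; apply: eq_bigr => c _.
  rewrite exchange_big /=; apply: eq_bigr => c' _.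
  by rewrite -cardE; apply: eq_bigr => v _; rewrite inE -natrM mulnb.
set G := finset _.
(* Off [G] the count [N] vanishes, so each such point contributes exactly [mu ^+ 2]. *)
have bad : mu ^+ 2 * #|~: G|%:R <= \sum_v (N v - mu) ^+ 2.
  rewrite -cardE mulr_sumr; apply: ler_sum => v _.
  rewrite finset.in_setC; case: (boolP (v \in G)) => [_|vG].
    by rewrite mulr0 sqr_ge0.
  rewrite mulr1 [N v]big1 ?sub0r ?sqrrN// => c cF; apply/eqP.
  rewrite pnatr_eq0 eqb0; apply: contra vG => vE.
  by rewrite inE; apply/existsP; exists c; rewrite cF.
have dev : \sum_v (N v - mu) ^+ 2 =
    \sum_v N v ^+ 2 - 2 * mu * \sum_v N v + mu ^+ 2 * #|V|%:R.
  rewrite mulr_sumr -sumrB -(cardsT V) -cardE mulr_sumr -big_split /=.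
  by apply: eq_bigr => v _; rewrite finset.in_setT mulr1; ring.
have {}bad : mu * #|~: G|%:R <= (1 + delta * mu) * #|V|%:R.
  rewrite -(ler_pM2l mu_gt0) mulrA -expr2; apply: le_trans bad _; rewrite dev.
  (* A lower bound on the mean suffices, as [\sum_v N v] enters [dev] with a negative
     coefficient. *)
  have := ler_wpM2l (ltW mu_gt0) N1.
  by move: N2; lra.
rewrite -(cardsC G) natrD -(ler_pM2l mu_gt0).
move: bad; rewrite -(cardsC G) natrD.
have -> : mu * ((1 - delta - mu^-1) * (#|G|%:R + #|~: G|%:R)) =
   (mu - delta * mu - 1) * (#|G|%:R + #|~: G|%:R).
  by field; rewrite gt_eqF.
lra.
Qed.

(** * From probabilities to counting *)

(** The event is the disjoint union, over the sequences [x] satisfying [Z], of the events that [X]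
    takes the value [x]; each has probability [n ^- m] by independence and uniformity. Row vectors
    make the sequences a finite type and fit matrix products. *)
Lemma random_Zn_sequence_prob (R : realType) (n m : nat) d (T : measurableType d)
    (P : probability T R) (X : 'I_m -> {RV P >-> 'Z_n})
    (Z : ('I_m -> 'Z_n) -> Prop) : random_Zn_sequence X ->
  P [set w | Z (fun i => X i w)] =
  (#|[set x : 'rV['Z_n]_m | `[< Z (x 0) >]]%SET|%:R / n%:R ^+ m)%:E.
Proof.
move=> [indX unifX].
set S := finset _.
have mX i (B : set 'Z_n) : measurable (X i @^-1` B).
  by rewrite -[X in measurable X]setTI; exact: measurable_funP.
pose F (x : 'rV['Z_n]_m) := \bigcap_(i in [set` [set: 'I_m]%SET]) (X i @^-1` [set x 0 i]).
have PF x : P (F x) = (n%:R ^- m)%:E.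
  rewrite indX//; under eq_bigr do rewrite unifX.
  by rewrite prodEFin prodr_const cardsT card_ord exprVn.
have -> : [set w | Z (fun i => X i w)] = \bigcup_(x in [set` enum S]) F x.
  apply/seteqP; split => w /=.
    move=> Zw; exists (\row_i X i w); last by move=> i _ /=; rewrite mxE.
    rewrite /= mem_enum inE; apply/asboolP.
    by rewrite (_ : _ 0 = fun i => X i w)//; apply/funext => i; rewrite mxE.
  move=> [x /=]; rewrite mem_enum inE => /asboolP Zx Fw.
  by rewrite (_ : (fun i => X i w) = x 0)//; apply/funext => i; apply: Fw; rewrite /= inE.
rewrite measure_fin_bigcup//; first last.
- by move=> x _; apply: fin_bigcap_measurable => // i _; exact: mX.
- move=> x y _ _ [w [Fx Fy]]; apply/rowP => i.
  have iT : i \in [set: 'I_m]%SET by rewrite inE.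
  by rewrite -(Fx i iT) -(Fy i iT).
rewrite -fsbig_seq ?enum_uniq// (eq_bigr (fun=> (n%:R ^- m)%:E)); last first.
  by move=> x _; exact: PF.
by rewrite sumEFin big_enum /= sumr_const mulr_natl.
Qed.

(** * Counting solutions of linear systems modulo [n] *)

Lemma card_Zp_ord (n : nat) : (1 < n)%N -> #|'Z_n| = n.
Proof. by move=> n1; rewrite card_ord Zp_cast. Qed.

Lemma card_rV_family (T : finType) (k e : nat) (D : 'I_k -> {set T}) :
  (forall j, #|D j| <= e)%N ->
  (#|[set w : 'rV[T]_k | [forall j, w 0%R j \in D j]]%SET| <= e ^ k)%N.
Proof.
move=> De; pose g (w : 'rV[T]_k) := [ffun j => w 0%R j].
have gI : injective g.
  by move=> v w /ffunP vw; apply/rowP => j; have := vw j; rewrite !ffunE.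
rewrite -(card_imset _ gI); apply: (@leq_trans #|family D|).
  apply/subset_leq_card/fintype.subsetP => _ /imsetP[w + ->].
  rewrite inE => /forallP Dw; apply/familyP => j; rewrite ffunE; exact: Dw.
rewrite card_family foldrE big_map big_enum /=.
have -> : (e ^ k = \prod_(j < k) e)%N by rewrite prod_nat_const card_ord.
by apply: leq_prod.
Qed.

Lemma card_mulr_unit_le1 (U : finUnitRingType) (d c : U) :
  d \is a GRing.unit -> (#|[set t | (d * t == c)%R]%SET| <= 1)%N.
Proof.
move=> du; rewrite -(cards1 (d^-1 * c)) subset_leq_card//.
by apply/fintype.subsetP => t; rewrite !inE => /eqP <-; rewrite mulKr.
Qed.

Section kernel.
Variables (n m k : nat).
Hypothesis n_gt1 : (1 < n)%N.
Implicit Types (C : 'M['Z_n]_(m, k)).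

(** The columns of [C] play the role of weight vectors: [x] must be annihilated by all of them at
    once. *)
Definition zn_ker C : {set 'rV['Z_n]_m} := [set x | x *m C == 0]%SET.

(** The map [x |-> x *m C] has at most [n ^ k] values, and each nonempty fibre is a translate of the
    kernel. *)
Lemma card_zn_ker_ge C : (n ^ m <= #|zn_ker C| * n ^ k)%N.
Proof.
have -> : (n ^ m = #|'rV['Z_n]_m|)%N by rewrite card_mx card_Zp_ord// mul1n.
have -> : (n ^ k = #|'rV['Z_n]_k|)%N by rewrite card_mx card_Zp_ord// mul1n.
rewrite mulnC -sum_nat_const -[leqLHS]sum1_card [leqLHS](partition_big (mulmxr C) predT)//=.
apply: leq_sum => w _.
case: (pickP [pred v : 'rV['Z_n]_m | v *m C == w]) => [v /= /eqP vw|none]; last first.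
  by rewrite big_pred0.
rewrite sum1_card -(card_imset _ (addrI (- v))) subset_leq_card//.
apply/fintype.subsetP => _ /imsetP[x xF ->].
have xw : x *m C = w by apply/eqP.
by rewrite inE mulmxDl mulNmx xw vw addNr.
Qed.

(* The adjugate of a square submatrix of determinant [d] gives [B] with
   [B *m C = d%:M]; then [(x, w) |-> x + w *m B], defined on the product of the
   kernel of [C] with ['rV_k], has fibres injecting into the solution sets of
   [d *: w = v *m C]. *)
Lemma card_zn_ker_le C (f : 'I_k -> 'I_m) (e : nat) :
  (forall c, #|[set t | (\det (rowsub f C) * t == c)%R]%SET| <= e)%N ->
  (#|zn_ker C| * n ^ k <= e ^ k * n ^ m)%N.
Proof.
set d := \det _ => de.
pose B := \adj (rowsub f C) *m rowsub f 1%:M.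
have BC : B *m C = d%:M by rewrite -mulmxA -rowsubE mul_adj_mx.
have -> : (n ^ m = #|'rV['Z_n]_m|)%N by rewrite card_mx card_Zp_ord// mul1n.
have -> : (n ^ k = #|[set: 'rV['Z_n]_k]%SET|)%N.
  by rewrite cardsT card_mx card_Zp_ord// mul1n.
rewrite -cardsX mulnC -sum_nat_const -[leqLHS]sum1_card.
rewrite [leqLHS](partition_big (fun u => u.1 + u.2 *m B) predT)//=.
apply: leq_sum => v _; rewrite sum1_card.
have := @card_rV_family _ k e
  (fun j => [set t | d * t == (v *m C) 0 j]%SET) (fun j => de _).
apply: leq_trans.
rewrite -(@card_in_imset _ _ (fun u => u.2)); last first.
  move=> [x w] [y z]; rewrite !unfold_in /= => /andP[_ /eqP <-] /andP[_ /eqP xy] wz.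
  by move: xy; rewrite wz => /addIr ->.
apply/subset_leq_card/fintype.subsetP => _ /imsetP[[x w] + ->] /=.
rewrite unfold_in /= !inE andbT => /andP[/eqP x0 /eqP <-].
apply/forallP => j; rewrite inE mulmxDl x0 add0r -mulmxA BC mul_mx_scalar.
by rewrite mxE.
Qed.

Lemma card_zn_ker_unit C (f : 'I_k -> 'I_m) :
  \det (rowsub f C) \is a GRing.unit -> (#|zn_ker C| * n ^ k <= n ^ m)%N.
Proof.
move=> du; rewrite -[leqRHS]mul1n -[X in (_ <= X * _)%N](exp1n k).
by apply: (@card_zn_ker_le C f) => c; exact: card_mulr_unit_le1.
Qed.

End kernel.

(** A solution [t] is determined by one bit: whether [2 * t], computed in the naturals, reaches the
    modulus. *)
Lemma card_double_le2 (n : nat) (c : 'Z_n) :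
  (#|[set t : 'Z_n | (2 * t == c)%R]%SET| <= 2)%N.
Proof.
rewrite -[leqRHS]card_bool.
apply: (@leq_card_in _ _ (fun t : 'Z_n => (Zp_trunc n).+2 <= 2 * t)%N) => s t.
rewrite !inE => /eqP <- /eqP /(congr1 val) /=.
have := ltn_ord s; have := ltn_ord t.
move: (Zp_trunc n) => k in s t *.
rewrite !modnMml (modn_small (m := 1)) //.
move=> tk sk st ss; apply/val_inj => /=.
have {}st : 2 * t = 2 * s %[mod k.+2] by [].
have half (r : nat) : (r < k.+2)%N ->
    ((2 * r) %% k.+2 = 2 * r - (k.+2 <= 2 * r) * k.+2)%N.
  move=> rk; case: (boolP (k.+2 <= 2 * r)%N) => rN.
    by rewrite mul1n -{1}(subnK rN) modnDr modn_small; lia.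
  by rewrite modn_small; lia.
move: st; rewrite !half// ss; case: leqP ss; case: leqP; lia.
Qed.

Lemma random_Zn_sequence_prob_ge (R : realType) (n m : nat) d
    (T : measurableType d) (P : probability T R) (X : 'I_m -> {RV P >-> 'Z_n})
    (Z : ('I_m -> 'Z_n) -> Prop) (G : {set 'rV['Z_n]_m}) (r : R) :
  (1 < n)%N -> random_Zn_sequence X ->
  (forall x, x \in G -> Z (x 0)) -> r * n%:R ^+ m <= #|G|%:R ->
  (r%:E <= P [set w | Z (fun i => X i w)])%E.
Proof.
move=> n1 rX GZ rG; rewrite random_Zn_sequence_prob// lee_fin ler_pdivlMr; last first.
  by rewrite exprn_gt0// ltr0n; lia.
apply: le_trans rG _; rewrite ler_nat subset_leq_card//.
by apply/fintype.subsetP => x /GZ Zx; rewrite inE; apply/asboolP.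
Qed.

(** * Kernels of one and of two weight vectors *)

Section pairs.
Variables (n m : nat).
Hypothesis n_gt1 : (1 < n)%N.
Implicit Types C : 'cV['Z_n]_m.

Lemma card_zn_ker1 C (i : 'I_m) : C i 0 \is a GRing.unit ->
  (#|zn_ker C| * n <= n ^ m)%N.
Proof.
move=> Ci; rewrite -[X in (_ * X)%N](expn1 n).
by apply: (@card_zn_ker_unit _ _ _ n_gt1 _ (fun=> i)); rewrite det_mx11 mxE.
Qed.

(** The intersection is the kernel of the two-column matrix [row_mx C C'], and the coefficient of
    [t] is its minor on the rows [i] and [j]. *)
Lemma card_zn_ker2 C C' (i j : 'I_m) (e : nat) :
  (forall c, #|[set t | ((C i 0 * C' j 0 - C' i 0 * C j 0) * t == c)%R]%SET| <= e)%N ->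
  (#|zn_ker C :&: zn_ker C'| * n ^ 2 <= e ^ 2 * n ^ m)%N.
Proof.
move=> de.
have -> : (zn_ker C :&: zn_ker C')%SET = zn_ker (row_mx C C').
  by apply/setP => x; rewrite !inE mul_mx_row row_mx_eq0.
apply: (@card_zn_ker_le _ _ (1 + 1) n_gt1 _ (fun r => if r == 0 then i else j)) => c.
suff -> : \det (rowsub (fun r : 'I_(1 + 1) => if r == 0 then i else j) (row_mx C C')) =
    C i 0 * C' j 0 - C' i 0 * C j 0 by exact: de.
have C0 r : row_mx C C' r 0 = C r 0.
  by rewrite -(row_mxEl C C'); congr (row_mx C C' r _); exact/val_inj.
have C1 r : row_mx C C' r 1 = C' r 0.
  by rewrite -(row_mxEr C C'); congr (row_mx C C' r _); exact/val_inj.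
move: (row_mx C C') C0 C1 => M C0 C1.
rewrite (expand_det_row _ 0) big_ord_recl big_ord1 /cofactor !det_mx11.
have l0 : lift 0 0 = 1 :> 'I_(1 + 1) by exact/val_inj.
have l1 : lift 1 0 = 0 :> 'I_(1 + 1) by exact/val_inj.
rewrite !mxE /= l0 l1 C0 C1 -[M i ord0]/(M i 0) C0 C1.
by rewrite /bump /= expr0 expr1 mul1r mulN1r mulrN.
Qed.

Lemma card_zn_ker2_unit C C' (i j : 'I_m) :
  C i 0 * C' j 0 - C' i 0 * C j 0 \is a GRing.unit ->
  (#|zn_ker C :&: zn_ker C'| * n ^ 2 <= n ^ m)%N.
Proof.
move=> du; rewrite -[leqRHS]mul1n -[X in (_ <= X * _)%N](exp1n 2).
apply: (@card_zn_ker2 _ _ i j) => c.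
exact: card_mulr_unit_le1.
Qed.

End pairs.

(** * The second moment method for families of weight vectors *)

(** The relation [r] marks pairs that may be dependent, with joint count up to 4 times the
    independent one; hence the factor [1 + 3 * r c c']. With at most [s] such partners for each [c],
    [second_moment] applies with [p = 1/n] and [delta = 3 * s / #|F|]. *)
Lemma zn_second_moment (R : realFieldType) (n m s : nat) (I : finType)
    (F : {set I}) (r : rel I) (C : I -> 'cV['Z_n]_m) :
  (1 < n)%N -> (0 < #|F|)%N ->
  (forall c, c \in F -> (#|zn_ker (C c)| * n <= n ^ m)%N) ->
  (forall c, c \in F -> (#|[set c' in F | r c c']%SET| <= s)%N) ->
  (forall c c', c \in F -> c' \in F -> c != c' ->
    (#|zn_ker (C c) :&: zn_ker (C c')| * n ^ 2 <= (1 + 3 * r c c') * n ^ m)%N) ->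
  (1 - (3 * s + n)%:R / #|F|%:R) * n%:R ^+ m <=
    #|[set x : 'rV['Z_n]_m | [exists c in F, x *m C c == 0]]%SET|%:R :> R.
Proof.
move=> n1 F0 single rs pair.
have n0 : 0 < n%:R :> R by rewrite ltr0n ltnW.
have F0R : 0 < #|F|%:R :> R by rewrite ltr0n.
have cardV : #|'rV['Z_n]_m|%:R = n%:R ^+ m :> R.
  by rewrite card_mx card_Zp_ord// mul1n natrX.
have sumr c : c \in F -> (\sum_(c' in F) r c c' <= s)%N.
  move=> /rs; apply: leq_trans; rewrite -sum1_card big_mkcond [leqRHS]big_mkcond.
  by apply: leq_sum => c' _; rewrite inE; case: (c' \in F) => //=; case: (r c c').
have pairs c : c \in F ->
    (\sum_(c' in F) #|zn_ker (C c) :&: zn_ker (C c')| * n ^ 2 <=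
     (n + #|F| + 3 * s) * n ^ m)%N.
  move=> cF; apply: (@leq_trans
      (\sum_(c' in F) ((c == c') * n + 1 + 3 * r c c') * n ^ m)%N).
    (* On the diagonal only one equation is imposed, which costs an extra factor [n]. *)
    apply: leq_sum => c' c'F; case: (eqVneq c c') => [<-|cc']; last first.
      by rewrite mul0n add0n pair.
    rewrite finset.setIid mul1n expnS expn1 mulnA [leqLHS]mulnC.
    rewrite -addnA mulnDl (leq_trans _ (leq_addr _ _))//.
    by rewrite leq_mul2l single// orbT.
  rewrite -big_distrl leq_mul2r; apply/orP; right => /=.
  rewrite big_split big_split /= -[X in (_ + X)%N]big_distrr /= sum1_card.
  rewrite leq_add// ?leq_mul2l ?sumr// leq_add2r.
  rewrite -big_distrl /= (bigD1 c)//= eqxx big1 ?addn0 ?mul1n//.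
  by move=> c' /andP[_ /negPf]; rewrite eq_sym => ->.
(* The error splits into [delta] and the inverse of the expected count [#|F| / n]. *)
have -> : 1 - (3 * s + n)%:R / #|F|%:R =
    1 - 3 * s%:R / #|F|%:R - (n%:R^-1 * #|F|%:R)^-1 :> R.
  by rewrite natrD natrM; field; rewrite !gt_eqF.
have -> : [set x | [exists c in F, x *m C c == 0]]%SET =
    [set x | [exists c in F, x \in zn_ker (C c)]]%SET.
  by apply/setP => x; rewrite !inE; apply: eq_existsb => c; rewrite inE.
rewrite -cardV; apply: second_moment; rewrite ?cardV.
- by rewrite mulr_gt0// invr_gt0.
- move=> c cF; rewrite mulrC ler_pdivrMr// -natrX -natrM ler_nat.
  by have := card_zn_ker_ge n1 (C c); rewrite expn1.
- rewrite -(ler_pM2r (exprn_gt0 2 n0)).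
  have -> : (n%:R^-1 * #|F|%:R + (1 + 3 * s%:R / #|F|%:R) * (n%:R^-1 * #|F|%:R) ^+ 2) *
      n%:R ^+ m * n%:R ^+ 2 = #|F|%:R * ((n + #|F| + 3 * s) * n ^ m)%:R :> R.
    by rewrite natrM 2!natrD natrM natrX; field; rewrite !gt_eqF.
  rewrite mulr_suml mulr_natl -sumr_const; apply: ler_sum => c cF.
  by rewrite -natr_sum -[in leLHS]natrX -natrM ler_nat big_distrl pairs.
Qed.

Lemma two_valued_weights (R : realFieldType) (n m : nat) (p q : 'Z_n) :
  (1 < n)%N -> (2 < m)%N ->
  p \is a GRing.unit \/ q \is a GRing.unit ->
  p + q \is a GRing.unit -> p - q \is a GRing.unit ->
  (1 - n%:R / 'C(m, 2)%:R) * n%:R ^+ m <=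
    #|[set x : 'rV['Z_n]_m | [exists A : {set 'I_m}, (#|A| == 2) &&
        (\sum_i (if i \in A then p else q) * x 0 i == 0)]]%SET|%:R :> R.
Proof.
move=> n1 m2 pq_unit pDq pBq.
pose C (A : {set 'I_m}) : 'cV['Z_n]_m := \col_i if i \in A then p else q.
pose F := [set A : {set 'I_m} | #|A| == 2]%SET.
have cF : #|F| = 'C(m, 2) by rewrite card_draws card_ord.
(* No two distinct 2-element sets are dependent, so [r] is empty and [s = 0]. *)
have := @zn_second_moment R n m 0 _ F (fun _ _ => false) C n1.
rewrite cF muln0 add0n => H; apply: le_trans (H _ _ _ _) _.
- by rewrite bin_gt0 ltnW.
- move=> A; rewrite inE => /eqP A2.
  have [i iA] : exists i, i \in A by apply/card_gt0P; rewrite A2.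
  have [j jA] : exists j, j \notin A.
    have /card_gt0P[j] : (0 < #|~: A|)%N by have := cardsC A; rewrite A2 card_ord; lia.
    by rewrite inE => ?; exists j.
  case: pq_unit => u; [apply: (card_zn_ker1 n1 (i := i))|apply: (card_zn_ker1 n1 (i := j))].
    by rewrite mxE iA.
  by rewrite mxE (negPf jA).
- by move=> A AF; rewrite leqn0 cards_eq0; apply/eqP/setP => B; rewrite !inE andbF.
- move=> A B; rewrite !inE => /eqP A2 /eqP B2 AB.
  (* Distinct sets of equal size do not contain one another; [i] and [j] from the two differences
     give the minor [p ^+ 2 - q ^+ 2]. *)
  have [i iA iB] : exists2 i, i \in A & i \notin B.
    by apply/subsetPn; apply: contra AB => AB; rewrite eqEcard AB A2 B2.
  have [j jB jA] : exists2 j, j \in B & j \notin A.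
    by apply/subsetPn; apply: contra AB => BA; rewrite eq_sym eqEcard BA A2 B2.
  rewrite mul1n; apply: (card_zn_ker2_unit n1 (i := i) (j := j)).
  rewrite !mxE iA (negPf iB) jB (negPf jA) -[X in X - _]expr2 -expr2.
  by rewrite subr_sqr unitrM pBq.
- rewrite ler_nat subset_leq_card//; apply/fintype.subsetP => x; rewrite !inE.
  move=> /existsP[A /andP[]]; rewrite inE => A2 /eqP/matrixP/(_ 0 0).
  rewrite !mxE => xC; apply/existsP; exists A; rewrite A2 /=; apply/eqP.
  by rewrite -[RHS]xC; apply: eq_bigr => i _; rewrite mxE mulrC.
Qed.

Lemma sign_weights (R : realFieldType) (n m : nat) :
  (1 < n)%N -> m = n.+1 -> (3 < m)%N ->
  (1 - 4 / m%:R) * n%:R ^+ m <=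
    #|[set x : 'rV['Z_n]_m | [exists kl : 'I_m * 'I_m, (kl.1 != kl.2) &&
        (\sum_i (if i == kl.1 then 0 else if i == kl.2 then -1 else 1) *
          x 0 i == 0)]]%SET|%:R :> R.
Proof.
move=> n1 mn m3.
(* As [lift k] enumerates the indices other than [k], ordered pairs of distinct indices form a full
   product type of size [m * n], with [n] pairs for each [k]. *)
pose C (c : 'I_m * 'I_m.-1) : 'cV['Z_n]_m :=
  \col_i if i == c.1 then 0 else if i == lift c.1 c.2 then -1 else 1.
have fresh (s : seq 'I_m) : (size s < m)%N -> exists i, i \notin s.
  move=> sm; have /card_gt0P[i] : (0 < #|[predC s]|)%N.
    by rewrite -(ltn_add2l #|s|) addn0 cardC card_ord (leq_ltn_trans (card_size s)).
  by rewrite inE => ?; exists i.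
have := @zn_second_moment R n m n _ [set: 'I_m * 'I_m.-1]%SET
  (fun c c' => c.1 == c'.1) C n1.
have -> : #|[set: 'I_m * 'I_m.-1]%SET| = (m * n)%N.
  by rewrite cardsT card_prod !card_ord mn.
have -> : (3 * n + n)%:R / (m * n)%:R = 4 / m%:R :> R.
  rewrite natrM natrD natrM; field.
  by rewrite !pnatr_eq0; lia.
move=> H; apply: le_trans (H _ _ _ _) _.
- by rewrite muln_gt0; lia.
- move=> [k l] _; have [i] : exists i, i \notin [:: k; lift k l]
    by apply: fresh; exact: ltnW.
  rewrite !inE negb_or => /andP[ik il].
  by apply: (card_zn_ker1 n1 (i := i)); rewrite mxE /= (negPf ik) (negPf il) unitr1.
- move=> [k l] _; have -> : [set c' in [set: 'I_m * 'I_m.-1] | (k, l).1 == c'.1]%SET =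
      finset.setX [set k]%SET [set: 'I_m.-1]%SET.
    by apply/setP => -[k' l']; rewrite !inE andbT eq_sym.
  by rewrite cardsX cards1 cardsT card_ord mul1n mn.
- move=> [k l] [k' l'] _ _ cc' /=.
  have [kk'|kk'] := eqVneq k k'.
    subst k'; have ll' : l != l' by apply: contraNneq cc' => ->.
    (* Since [3 < m], some index has weight 1 in both vectors; with the row [lift k l] it gives the
       minor [1 * 1 - 1 * (-1) = 2]. *)
    have [i] : exists i, i \notin [:: k; lift k l; lift k l'] by apply: fresh.
    rewrite !inE !negb_or => /and3P[ik il il'].
    change (#|zn_ker (C (k, l)) :&: zn_ker (C (k, l'))| * n ^ 2 <= 2 ^ 2 * n ^ m)%N.
    apply: (card_zn_ker2 n1 (i := i) (j := lift k l)) => c.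
    rewrite !mxE /= (negPf ik) (negPf il) (negPf il') !eqxx.
    rewrite eq_sym (negPf (neq_lift _ _)) (inj_eq lift_inj) (negPf ll').
    by rewrite !mul1r opprK; exact: card_double_le2.
  (* Each vector vanishes at its own [k], so this minor is, up to sign, a product of two weights
     equal to 1 or -1. *)
  rewrite mul1n; apply: (card_zn_ker2_unit n1 (i := k) (j := k')).
  rewrite !mxE /= !eqxx mul0r sub0r unitrN [k' == k]eq_sym (negPf kk').
  by rewrite unitrM; do 2 case: ifP => _; rewrite ?unitrN unitr1.
- rewrite ler_nat subset_leq_card//; apply/fintype.subsetP => x; rewrite !inE.
  move=> /existsP[[k l] /andP[_ /eqP/matrixP/(_ 0 0)]].
  rewrite !mxE => xC; apply/existsP; exists (k, lift k l).
  rewrite /= neq_lift /=; apply/eqP; rewrite -[RHS]xC.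
  by apply: eq_bigr => i _; rewrite mxE mulrC.
Qed.

(** * Choice of the threshold and the three statements *)

(** One threshold serves all three statements: the error terms are at most [2 / (n - 1)] in (1) and
    (2), and [4 / (n + 1)] in (3). *)
Lemma exists_large_nat (R : archiRealFieldType) (eps : R) : 0 < eps ->
  exists n0 : nat, forall n, (n0 <= n)%N -> (2 < n)%N /\ 4 <= eps * n.-1%:R.
Proof.
move=> e0; exists (Num.truncn (4 / eps)).+3 => n n0n; split; first by lia.
rewrite mulrC -ler_pdivrMr//; apply: ltW; apply: lt_le_trans (truncnS_gt _) _.
by rewrite ler_nat; case: n n0n => // n /ltnW.
Qed.

(** The worst case is [m = n], where the quotient equals [2 / (n - 1)]. *)
Lemma div_bin2_le (R : realFieldType) (eps : R) (n m : nat) : 0 < eps ->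
  (2 < n <= m)%N -> 4 <= eps * n.-1%:R -> n%:R / 'C(m, 2)%:R <= eps.
Proof.
move=> e0 /andP[n2 nm] en.
have C0 : (0 < 'C(m, 2))%N by rewrite bin_gt0; lia.
rewrite ler_pdivrMr ?ltr0n// (@le_trans _ _ (eps * 'C(n, 2)%:R))//; last first.
  by rewrite ler_pM2l// ler_nat leq_bin2l.
have := mul_bin_diag n 1; rewrite bin1 => /(congr1 (fun k => k%:R : R)).
rewrite !natrM => H.
have : 4 * n%:R <= eps * n.-1%:R * n%:R by rewrite ler_wpM2r.
have -> : eps * n.-1%:R * n%:R = 2 * (eps * 'C(n, 2)%:R).
  by rewrite mulrCA -H -mulrA [n%:R * _]mulrC.
have : 0 <= n%:R :> R by [].
lra.
Qed.

Theorem theorem2 (R : realType) :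
  [/\ (* (1) *)
      forall eps : R, 0 < eps -> exists n0 : nat, forall n : nat,
        (n0 <= n)%N -> (1 < n)%N ->
        forall (d : measure_display) (T : measurableType d)
          (P : probability T R) (X : 'I_(n + 2) -> {RV P >-> 'Z_n}),
          random_Zn_sequence X ->
          ((1 - eps)%:E <= P [set w | erdos_zseq (fun i => X i w)])%E,
      (* (2) *)
      forall eps : R, 0 < eps -> exists n0 : nat, forall n : nat,
        (n0 <= n)%N -> (1 < n)%N ->
        forall (A : {set 'Z_n}) (a b : 'Z_n),
          A = [set a; b]%SET -> 0 \notin A ->
          (exists2 u, u \in A & u \is a GRing.unit) ->
          a + b \is a GRing.unit -> a - b \is a GRing.unit ->
        forall (d : measure_display) (T : measurableType d)
          (P : probability T R) (X : 'I_n -> {RV P >-> 'Z_n}),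
          random_Zn_sequence X ->
          ((1 - eps)%:E <= P [set w | weighted_erdos_zseq A (fun i => X i w)])%E
    & (* (3) *)
      forall eps : R, 0 < eps -> exists n0 : nat, forall n : nat,
        (n0 <= n)%N -> (1 < n)%N ->
        forall (d : measure_display) (T : measurableType d)
          (P : probability T R) (X : 'I_(n + 1) -> {RV P >-> 'Z_n}),
          random_Zn_sequence X ->
          ((1 - eps)%:E <=
            P [set w | weighted_erdos_zseq [set 1%R; (-1)%R]%SET (fun i => X i w)])%E].
Proof.
split => eps eps_gt0; have [n0 Hn0] := exists_large_nat eps_gt0;
    exists n0 => n /Hn0[n2 en] n1.
- move=> d T P X rX.
  have n_ge0 : 0 <= n%:R ^+ (n + 2) :> R by exact: exprn_ge0.
  have m_gt2 : (2 < n + 2)%N by rewrite ltn_addr.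
  have u01 : (0 : 'Z_n) \is a GRing.unit \/ (1 : 'Z_n) \is a GRing.unit.
    by right; exact: unitr1.
  have uD : 0 + 1 \is a @GRing.unit 'Z_n by rewrite add0r unitr1.
  have uB : 0 - 1 \is a @GRing.unit 'Z_n by rewrite sub0r unitrN unitr1.
  have := two_valued_weights R n1 m_gt2 u01 uD uB; set G := finset _ => cG.
  apply: (random_Zn_sequence_prob_ge (G := G) n1 rX); last first.
    apply: le_trans cG; rewrite ler_wpM2r// lerD2l lerN2.
    by apply: div_bin2_le en; rewrite // n2 leq_addr.
  move=> x; rewrite inE => /existsP[A /andP[/eqP A2 /eqP xA]].
  (* The two indices in [A] are dropped, which leaves [n] of the [n + 2] terms. *)
  exists (fun i => if i \in A then 0 else 1); split => //.
    by move=> i; rewrite !inE; case: ifP.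
  rewrite (_ : finset _ = ~: A)%SET; last first.
    by apply/setP => i; rewrite !inE; case: ifP; rewrite ?eqxx ?oner_eq0.
  by rewrite cardsCs finset.setCK A2 card_ord addnK.
- move=> A a b Aab A0 Aunit uD uB d T P X rX.
  have n_ge0 : 0 <= n%:R ^+ n :> R by exact: exprn_ge0.
  have uab : a \is a GRing.unit \/ b \is a GRing.unit.
    by move: Aunit => [u]; rewrite Aab !inE => /orP[] /eqP ->; [left|right].
  have := two_valued_weights R n1 n2 uab uD uB; set G := finset _ => cG.
  apply: (random_Zn_sequence_prob_ge (G := G) n1 rX); last first.
    apply: le_trans cG; rewrite ler_wpM2r// lerD2l lerN2.
    by apply: div_bin2_le en; rewrite // n2 /=.
  move=> x; rewrite inE => /existsP[I /andP[_ /eqP xI]].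
  have wA i : (if i \in I then a else b) \in A.
    by rewrite Aab !inE; case: ifP; rewrite eqxx ?orbT.
  exists (fun i => if i \in I then a else b); split => //.
    by move=> i; rewrite inE wA orbT.
  rewrite (_ : finset _ = [set: 'I_n]%SET) ?cardsT ?card_ord//.
  (* All [n] weights lie in [A], hence are nonzero. *)
  by apply/setP => i; rewrite !inE; apply: contraNneq A0 => <-.
- move=> d T P X rX.
  have n_ge0 : 0 <= n%:R ^+ (n + 1) :> R by exact: exprn_ge0.
  have m_gt3 : (3 < n + 1)%N by rewrite addn1.
  have := sign_weights R n1 (addn1 n) m_gt3; set G := finset _ => cG.
  apply: (random_Zn_sequence_prob_ge (G := G) n1 rX); last first.
    apply: le_trans cG; rewrite ler_wpM2r// lerD2l lerN2.
    rewrite ler_pdivrMr ?ltr0n ?addn1// (le_trans en)// ler_pM2l// ler_nat.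
    by case: (n) => // k; rewrite ltnW.
  move=> x; rewrite inE => /existsP[[k l] /andP[_ /eqP xkl]].
  exists (fun i => if i == k then 0 else if i == l then -1 else 1); split => //.
    by move=> i; rewrite !inE; case: ifP => _; [|case: ifP => _]; rewrite eqxx ?orbT.
  (* Only the weight at [k] vanishes, which leaves [n] of the [n + 1] terms. *)
  rewrite (_ : finset _ = [set~ k]%SET); last first.
    apply/setP => i; rewrite !inE; case: ifP => _; first by rewrite eqxx.
    by case: ifP => _; rewrite ?oppr_eq0 oner_eq0.
  by rewrite cardsC1 card_ord addn1.
Qed.
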